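(* If $H$ is an edge-ordered $d$-degenerate graph on $n$ vertices, then $r_{\text{edge}}(H)\le n^{600d^3\log_2(d+1)}$.
   Context: An edge-ordered graph is a finite simple graph together with a total ordering of its edges (equivalently, an assignment of distinct integer labels to its edges). Two edge-ordered graphs are equivalent if there is a graph isomorphism between them preserving the ordering of the edges; a copy of $H$ in $G$ is a subgraph of $G$ (with inherited edge-ordering) equivalent to $H$. The edge-ordered Ramsey number $r_{\text{edge}}(H)$ is the smallest $N$ such that there exists an edge-ordered graph $G$ on $N$ vertices such that every two-coloring of the edges of $G$ contains a monochromatic copy of $H$. A graph is $d$-degenerate if every induced subgraph has a vertex of degree at most $d$.
   Formalization: The formal theorem assumes d ≥ 1; for d = 0 the stated bound is n^0 = 1, which fails for the edgeless graph on n ≥ 2 vertices, whose edge-ordered Ramsey number is n. *)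

(* Defs.v *)
From mathcomp Require Import all_boot all_order all_algebra.
From mathcomp Require Import reals exp.

Set Implicit Arguments.
Unset Strict Implicit.
Unset Printing Implicit Defensive.

(* The vertex set is a subset of an ambient finite type [V], so that a graph
   and its subgraphs live in the same type.  [edge_le] orders the edges
   totally; its values outside [edges] are irrelevant. Reflexivity on the
   edges follows from totality. *)
Record eograph (V : finType) := EOGraph {
  vertices : {set V};
  edges : {set {set V}};
  edge_le : rel {set V};
  edges_card2 : {in edges, forall e : {set V}, #|e| = 2};
  edges_sub : {in edges, forall e : {set V}, e \subset vertices};
  edge_le_anti : {in edges &, antisymmetric edge_le};
  edge_le_trans : {in edges & &, transitive edge_le};
  edge_le_total : {in edges &, total edge_le}
}.

Definition equivalent (V W : finType) (H : eograph V) (K : eograph W) : Prop :=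
  exists f : V -> W,
    [/\ {in vertices H &, injective f},
        f @: vertices H = vertices K,
        {in vertices H &, forall u v : V,
           ([set f u; f v] \in edges K) = ([set u; v] \in edges H)}
      & {in edges H &, forall e1 e2 : {set V},
           edge_le K (f @: e1) (f @: e2) = edge_le H e1 e2}].

Definition subgraph (W : finType) (K G : eograph W) : Prop :=
  [/\ vertices K \subset vertices G,
      edges K \subset edges G
    & {in edges K &, forall e1 e2 : {set W},
         edge_le K e1 e2 = edge_le G e1 e2}].

Definition is_copy (V W : finType) (H : eograph V) (G K : eograph W) : Prop :=
  subgraph K G /\ equivalent H K.

(* Only the values of the colouring on the edges of the graph matter. *)
Definition monochromatic (W : finType) (chi : {set W} -> bool)
    (K : eograph W) : Prop :=
  exists c : bool, {in edges K, forall e : {set W}, chi e = c}.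

Definition ramsey_for (V W : finType) (H : eograph V) (G : eograph W) : Prop :=
  forall chi : {set W} -> bool,
    exists K : eograph W, is_copy H G K /\ monochromatic chi K.

Definition has_ramsey_graph (V : finType) (H : eograph V) (N : nat) : Prop :=
  exists (W : finType) (G : eograph W), #|vertices G| = N /\ ramsey_for H G.

(* [is_redge H N]: the edge-ordered Ramsey number of [H] exists and is [N]. *)
Definition is_redge (V : finType) (H : eograph V) (N : nat) : Prop :=
  has_ramsey_graph H N /\ forall M : nat, has_ramsey_graph H M -> N <= M.

Definition induced_edges (V : finType) (H : eograph V) (S : {set V}) :
  {set {set V}} := [set e in edges H | e \subset S].

Definition degree_in (V : finType) (F : {set {set V}}) (v : V) : nat :=
  #|[set e in F | v \in e]|.

Definition degenerate (V : finType) (d : nat) (H : eograph V) : Prop :=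
  forall S : {set V}, S \subset vertices H -> S != set0 ->
    exists2 v, v \in S & degree_in (induced_edges H S) v <= d.

Definition log2 (R : realType) (x : R) : R := (ln x / ln 2)%R.

(* Main.v *)
Require Import Defs.
From mathcomp Require Import all_boot all_order all_algebra.
From mathcomp Require Import unstable boolp reals exp.
From mathcomp Require Import zify.

(* Label the edges of a complete graph pseudorandomly by words of length
   [2 ^ K] over an alphabet of [n ^ 2] letters, at least as many as [H] has
   edges, and order them by label.  Given a prefix [p], try to embed a red copy
   of [H] greedily, in a degeneracy order, giving the edge of rank [r] a label
   that extends [p r]: any such embedding respects the order.  If this fails,
   then for some [r] there are large sets [A] and [B] with very few red pairs
   whose label extends [p r].  Repeating this inside [A], and then inside [B],
   with ever longer prefixes yields [2 ^ K > d] large sets and one prefix of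
   length [2 ^ K - 1] such that very few pairs between two of the sets are red
   with a label extending that prefix.  As [H] is [d + 1]-colourable, a blue
   copy can be embedded greedily into these sets, the rank of an edge now being
   the last letter of its label: there are pairs with any given label between
   any two large sets, and too few of them are red to block the embedding.
   The red embedding loses a factor [n ^ O(d ^ 2)] per back-neighbour, hence
   [n ^ O(d ^ 3)] per doubling step, and [K = O(log d)]. *)

Set Implicit Arguments.
Unset Strict Implicit.
Unset Printing Implicit Defensive.

(** * Greedy embedding *)

Lemma exists_subset_card (T : finType) (S : {set T}) (k : nat) :
  k <= #|S| -> exists2 Q : {set T}, Q \subset S & #|Q| = k.
Proof.
move=> kS; exists [set x in take k (enum S)].
  by apply/subsetP => x; rewrite inE => /mem_take; rewrite mem_enum.
rewrite cardsE (card_uniqP _) ?take_uniq ?enum_uniq //.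
by rewrite size_takel // -cardE.
Qed.

(** Pairwise disjoint candidate sets are what makes a greedy embedding injective. *)
Lemma exists_disjoint_family (V W : finType) (T : {set V}) (S : {set W})
    (q : nat) :
  #|T| * q <= #|S| ->
  exists C : V -> {set W}, [/\ {in T, forall v, C v \subset S},
    {in T, forall v, #|C v| = q}
    & {in T &, forall u v, u != v -> [disjoint C u & C v]}].
Proof.
elim: {T}#|T| {-2}T (erefl #|T|) S => [|k IH] T cT S leS.
  move/eqP: cT; rewrite cards_eq0 => /eqP ->.
  by exists (fun=> set0); split=> v; rewrite in_set0.
have /card_gt0P [v vT] : 0 < #|T| by rewrite cT.
have [|Q QS cQ] := @exists_subset_card W S q.
  by apply: leq_trans leS; rewrite cT mulSn leq_addr.
have cT' : #|T :\ v| = k by move: cT; rewrite (cardsD1 v) vT => -[].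
have [|C [CS Cq Cd]] := IH (T :\ v) cT' (S :\: Q).
  by rewrite cT' cardsDS // cQ; move: leS; rewrite cT; lia.
have inT' u : u \in T -> u != v -> u \in T :\ v by move=> uT uv; rewrite !inE uv.
exists (fun u => if u == v then Q else C u); split=> [u uT|u uT|u w uT wT uw].
- case: eqP => [//|/eqP uv].
  exact: subset_trans (CS _ (inT' _ uT uv)) (subsetDl _ _).
- by case: eqP => [//|/eqP uv]; apply: Cq; exact: inT'.
have dQ z : z \in T -> z != v -> [disjoint Q & C z].
  move=> zT zv; rewrite disjoint_sym disjoints_subset.
  by apply: subset_trans (CS _ (inT' _ zT zv)) _; rewrite setDE subsetIr.
case: (eqVneq u v) => [uv|uv]; case: (eqVneq w v) => [wv|wv].
- by rewrite uv wv eqxx in uw.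
- exact: dQ.
- by rewrite disjoint_sym; exact: dQ.
- by apply: Cd; rewrite ?inT'.
Qed.

Definition back_degenerate (V : eqType) (adj : rel V) (d : nat) (s : seq V) :=
  forall s1 v s2, s = s1 ++ v :: s2 -> count (adj v) s1 <= d.

Section GreedyEmbedding.
Variables (V W : finType) (adj : rel V) (R : V -> V -> rel W) (d g n : nat).
Variables (s : seq V) (C : V -> {set W}).
Hypotheses (uniq_s : uniq s) (size_s : size s <= n).
Hypothesis adj_sym : symmetric adj.
Hypothesis adj_irr : irreflexive adj.
Hypothesis R_sym : forall u v x y, R u v x y = R v u y x.
Hypothesis deg_s : back_degenerate adj d s.
Hypothesis C_gt0 : forall v, v \in s -> 0 < #|C v|.
Hypothesis g_gt0 : 0 < g.

(** [X] stands for a set of bad choices for [u]: after at most [d] losses of a factor [g], the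
    candidates fill a share [1 / g ^ d] of [C u], and a bad set matters only if it fills a share
    [1 / n] of them. *)
Hypothesis R_rich : forall (u v : V) (X Y : {set W}),
  u \in s -> v \in s -> adj u v -> X \subset C u -> Y \subset C v ->
  #|C u| <= n * g ^ d * #|X| -> #|C v| <= g ^ d * #|Y| ->
  exists2 w, w \in X & #|Y| <= g * #|[set y in Y | R u v w y]|.

Let cand (s1 : seq V) (f : V -> W) v :=
  [set y in C v | all (fun u => adj v u ==> R u v (f u) y) s1].

(** Each embedded neighbour costs a later vertex at most a factor [g] of its candidates. *)
Let invariant (s1 s2 : seq V) f := [/\ {in s1, forall u, f u \in C u},
  {in s1 &, forall u v, adj u v -> R u v (f u) (f v)}
  & {in s2, forall v, #|C v| <= g ^ count (adj v) s1 * #|cand s1 f v|}].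

(** A choice is bad if it leaves some later neighbour [j] less than a share [1 / g] of its
    candidates. By [R_rich] each [j] spoils less than a share [1 / n] of the choices, so one
    survives. *)
Let greedy_step s1 v s2 f : s = s1 ++ v :: s2 -> invariant s1 (v :: s2) f ->
  exists f', invariant (rcons s1 v) s2 f'.
Proof.
move=> def_s [fC fR fc].
have vs : v \in s by rewrite def_s mem_cat mem_head orbT.
have sub2 u : u \in s2 -> u \in s.
  by rewrite def_s mem_cat inE => ->; rewrite !orbT.
have vns1 : v \notin s1.
  by move: uniq_s; rewrite def_s cat_uniq /= negb_or => /and3P [_ /andP []].
pose bad j := [set w in cand s1 f v |
  g * #|[set y in cand s1 f j | R v j w y]| < #|cand s1 f j|].
have gexp k : k <= d -> g ^ k <= g ^ d by move=> kd; rewrite leq_pexp2l.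
have dv : count (adj v) s1 <= d by exact: deg_s def_s.
have cv_gt0 : 0 < #|cand s1 f v|.
  have := fc v (mem_head _ _); have := C_gt0 vs.
  by case: #|cand _ _ _| => // + +; rewrite muln0; lia.
have bad_small j : j \in s2 -> adj v j -> n * #|bad j| < #|cand s1 f v|.
  move=> js2 avj; rewrite ltnNge; apply/negP => big.
  have dj : (count (adj j) s1).+1 <= d.
    case/splitPr: js2 def_s => t1 t2 def_s.
    have := @deg_s (s1 ++ v :: t1) j t2; rewrite -catA /= => /(_ def_s).
    by rewrite count_cat /= adj_sym avj; lia.
  have [||||w] := @R_rich v j (bad j) (cand s1 f j) vs (sub2 _ js2) avj.
  - by apply/subsetP => w; rewrite !inE => /andP [/andP []].
  - by apply/subsetP => w; rewrite !inE => /andP [].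
  - apply: leq_trans (fc v (mem_head _ _)) _.
    rewrite -mulnA mulnCA.
    by apply: leq_mul big; apply: gexp.
  - apply: leq_trans (fc j _) _; first by rewrite inE js2 orbT.
    by rewrite leq_mul2r gexp ?orbT // ltnW.
  by rewrite inE => /andP [_]; rewrite ltnNge => /negP.
have [w wc wb] : exists2 w, w \in cand s1 f v &
    {in s2, forall j, adj v j -> w \notin bad j}.
  pose B := \bigcup_(j in [set j in s2 | adj v j]) bad j.
  have ltB : #|B| < #|cand s1 f v|.
    (* Bounding each term by a predecessor keeps strictness, even over an empty index set. *)
    have leB : n * #|B| <= \sum_(j in [set j in s2 | adj v j]) #|cand s1 f v|.-1.
      apply: (@leq_trans (n * \sum_(j in [set j in s2 | adj v j]) #|bad j|)).
        by rewrite leq_mul2l card_big_setU orbT.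
      rewrite big_distrr /=; apply: leq_sum => j; rewrite !inE => /andP [js aj].
      by have := bad_small j js aj; lia.
    have cn : #|[set j in s2 | adj v j]| <= n.
      apply: leq_trans size_s; rewrite def_s size_cat /=.
      apply: (@leq_trans #|s2|); last by apply: leq_trans (card_size _) _; lia.
      by apply: subset_leq_card; apply/subsetP => j; rewrite !inE => /andP [].
    have n_gt0 : 0 < n by move: size_s; rewrite def_s size_cat /=; lia.
    move: leB; rewrite sum_nat_const => leB.
    have : n * #|B| <= n * #|cand s1 f v|.-1.
      by apply: leq_trans leB _; rewrite leq_mul2r cn orbT.
    by rewrite leq_pmul2l //; lia.
  have : ~~ (cand s1 f v \subset B).
    by apply/negP => /subset_leq_card; rewrite leqNgt ltB.
  case/subsetPn => w wc wB; exists w => // j js aj.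
  apply/negP => wbad; case/negP: wB.
  by apply/bigcupP; exists j => //; rewrite inE js aj.
pose f' u := if u == v then w else f u.
have f's1 u : u \in s1 -> f' u = f u.
  by rewrite /f'; case: eqP => // ->; rewrite (negPf vns1).
have f'v : f' v = w by rewrite /f' eqxx.
have wR u : u \in s1 -> adj v u -> R u v (f u) w.
  by move=> us a; move: wc; rewrite inE => /andP [_ /allP /(_ u us)]; rewrite a.
exists f'; split=> [u|u u'|j js].
- rewrite mem_rcons inE => /orP [/eqP ->|us]; last by rewrite f's1 ?fC.
  by rewrite f'v; move: wc; rewrite inE => /andP [].
- rewrite !mem_rcons !inE => /orP [/eqP ->|us] /orP [/eqP ->|us'] a.
  + by rewrite adj_irr in a.
  + by rewrite f'v f's1 // R_sym; exact: wR.
  + by rewrite f'v f's1 //; apply: wR => //; rewrite adj_sym.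
  + by rewrite !f's1 //; exact: fR.
have candE : cand (rcons s1 v) f' j =
    [set y in cand s1 f j | adj j v ==> R v j w y].
  apply/setP => y; rewrite !inE all_rcons f'v -andbA; congr (_ && _).
  rewrite andbC; congr (_ && _); apply: eq_in_all => u us.
  by rewrite f's1.
have fcj := fc j (mem_behead (js : j \in behead (v :: s2))).
rewrite candE -cats1 count_cat /= addn0.
case a: (adj j v); last first.
  rewrite addn0; apply: leq_trans fcj _; rewrite leq_mul2l; apply/orP; right.
  by apply: subset_leq_card; apply/subsetP => y yc; rewrite inE yc.
have := wb j js; rewrite adj_sym a => /(_ isT); rewrite inE wc /= -leqNgt => le.
rewrite addn1 expnSr -mulnA; apply: leq_trans fcj _.
by rewrite leq_mul2l le orbT.
Qed.

Lemma greedy_embedding (w0 : W) : exists f : V -> W,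
  {in s, forall u, f u \in C u} /\
  {in s &, forall u v, adj u v -> R u v (f u) (f v)}.
Proof.
suff main s2 s1 f : s = s1 ++ s2 -> invariant s1 s2 f ->
    exists f', invariant s nil f'.
  (* [w0] is a placeholder for vertices not yet embedded. *)
  have [|f [fC fR _]] := main s nil (fun=> w0) erefl; last by exists f.
  split=> // v _; rewrite mul1n; apply: subset_leq_card.
  by apply/subsetP => y yC; rewrite inE yC.
elim: s2 s1 f => [|v s2 IH] s1 f def_s inv.
  by exists f; rewrite {1}def_s cats0.
have [f' inv'] := greedy_step def_s inv.
by apply: IH inv'; rewrite cat_rcons.
Qed.
End GreedyEmbedding.

(** * Degeneracy orders and colourings *)

Definition hereditarily_degenerate (V : finType) (adj : rel V) (d : nat)
    (T : {set V}) :=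
  forall S : {set V}, S \subset T -> S != set0 ->
    exists2 v, v \in S & #|[set u in S | adj v u]| <= d.

Lemma hereditarily_degenerateS (V : finType) (adj : rel V) d (S T : {set V}) :
  S \subset T -> hereditarily_degenerate adj d T ->
  hereditarily_degenerate adj d S.
Proof. by move=> ST degT U US; apply: degT; apply: subset_trans ST. Qed.

(** A vertex of degree at most [d] goes last, after an ordering of the others. *)
Lemma degeneracy_order (V : finType) (adj : rel V) (d : nat) (T : {set V}) :
  irreflexive adj -> hereditarily_degenerate adj d T ->
  exists s : seq V, [/\ uniq s, s =i T & back_degenerate adj d s].
Proof.
move=> adj_irr; elim: {T}#|T| {-2}T (erefl #|T|) => [|k IH] T cT degT.
  move/eqP: cT; rewrite cards_eq0 => /eqP ->.
  exists [::]; split=> // [v|[|u s1] v s2] //; first by rewrite in_set0.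
have T_neq0 : T != set0 by rewrite -card_gt0 cT.
have [v vT dv] := degT T (subxx _) T_neq0.
have cT' : #|T :\ v| = k by move: cT; rewrite (cardsD1 v) vT => -[].
have [s [us sT bs]] := IH _ cT' (hereditarily_degenerateS (subD1set _ _) degT).
have vns : v \notin s by rewrite sT !inE eqxx.
exists (rcons s v); split=> [|u|s1 u s2].
- by rewrite rcons_uniq vns us.
- rewrite mem_rcons inE sT !inE; case: eqP => [->|_] //=.
- case/lastP: s2 => [|s2 w].
    rewrite cats1 => /rcons_inj [<- <-]; apply: leq_trans dv.
    rewrite -size_filter -(card_uniqP _) ?filter_uniq //.
    apply: subset_leq_card; apply/subsetP => w.
    rewrite mem_filter inE => /andP [-> ].
    by rewrite sT !inE => /andP [_ ->].
  by rewrite -rcons_cons -rcons_cat => /rcons_inj [/bs].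
Qed.

(** Colour all but a vertex of degree at most [d]; its neighbours block at most [d < k] colours. *)
Lemma degenerate_coloring (V : finType) (adj : rel V) (d k : nat)
    (T : {set V}) :
  symmetric adj -> irreflexive adj -> d < k ->
  hereditarily_degenerate adj d T ->
  exists c : V -> 'I_k, {in T &, forall u v, adj u v -> c u != c v}.
Proof.
move=> adj_sym adj_irr ltdk.
elim: {T}#|T| {-2}T (erefl #|T|) => [|m IH] T cT degT.
  move/eqP: cT; rewrite cards_eq0 => /eqP ->.
  by exists (fun=> Ordinal ltdk) => u v; rewrite in_set0.
have T_neq0 : T != set0 by rewrite -card_gt0 cT.
have [v vT dv] := degT T (subxx _) T_neq0.
have cT' : #|T :\ v| = m by move: cT; rewrite (cardsD1 v) vT => -[].
have [c cP] := IH _ cT' (hereditarily_degenerateS (subD1set _ _) degT).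
have [i inew] : exists i, i \notin [set c u | u in [set u in T | adj v u]].
  apply/existsP; rewrite -negb_forall; apply/negP => /forallP all_i.
  have : #|'I_k| <= d.
    apply: leq_trans dv; apply: leq_trans (leq_imset_card c _).
    by apply: subset_leq_card; apply/subsetP => i _; apply: all_i.
  by rewrite card_ord leqNgt ltdk.
have inew' u : u \in T -> adj v u -> c u != i.
  move=> uT a; apply/eqP => cu; case/negP: inew; apply/imsetP.
  by exists u; rewrite ?inE ?uT ?a.
exists (fun u => if u == v then i else c u) => u w uT wT.
case: (eqVneq u v) => [->|uv]; case: (eqVneq w v) => [->|wv].
- by rewrite adj_irr.
- by move=> a; rewrite eq_sym inew'.
- by rewrite adj_sym; apply: inew'.
- by apply: cP; rewrite !inE ?uv ?wv.
Qed.

(** * Pseudorandom labellings *)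

Lemma leq_bin_exp n k : 'C(n, k) <= n ^ k.
Proof.
apply: (@leq_trans (n ^_ k)).
  by rewrite -bin_ffact leq_pmulr ?fact_gt0.
elim: k => [|k IH]; first by rewrite ffactn0.
by rewrite ffactnSr expnSr leq_mul ?leq_subr.
Qed.

(** This is [(1 - 1/M)^M <= 1/2]: the two top terms in the expansion of [((M - 1) + 1)^(M - 1)] both
    equal [(M - 1)^(M - 1)]. *)
Lemma double_expn_pred M : 0 < M -> 2 * M.-1 ^ M <= M ^ M.
Proof.
case: M => // M _ /=; case: M => [|M] //.
rewrite expnS mulnCA [M.+2 ^ _]expnS.
have le : M.+1 ^ M.+1 <= M.+2 ^ M.+1 by rewrite leq_exp2r.
suff : M.+1 ^ M.+1 + M.+1 ^ M.+1 <= M.+2 ^ M.+1 by nia.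
have -> : M.+2 ^ M.+1 = \sum_(i < M.+2) 'C(M.+1, i) * (1 ^ (M.+1 - i) * M.+1 ^ i).
  by rewrite -expnDn add1n.
rewrite big_ord_recr big_ord_recr /= !exp1n !mul1n binn mul1n leq_add2r.
by rewrite (binSn M) -expnS leq_addl.
Qed.

Lemma double_expn_pred_exp M k m :
  0 < M -> M * k <= m -> 2 ^ k * M.-1 ^ m <= M ^ m.
Proof.
move=> M_gt0 /subnKC <-; rewrite !expnD mulnA.
apply: leq_mul; last by case: (m - _) => // e; rewrite leq_exp2r ?leq_pred.
by rewrite !expnM -expnMn; case: k => // k; rewrite leq_exp2r ?double_expn_pred.
Qed.

Lemma card_pairs (T : finType) (X Y : {set T}) : [disjoint X & Y] ->
  #|[set [set x; y] | x in X, y in Y]| = #|X| * #|Y|.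
Proof.
move=> dXY; rewrite -cardsX curry_imset2X card_in_imset //.
move=> [x y] [x' y']; rewrite !inE /= => /andP [xX yY] /andP [xX' yY'] E.
have ne a b : a \in X -> b \in Y -> a == b = false.
  by move=> aX bY; apply/eqP => ab; move/disjointFr: dXY => /(_ _ aX); rewrite ab bY.
have : x \in [set x'; y'] by rewrite -[[set _; _]]E set21.
have : y \in [set x'; y'] by rewrite -[[set _; _]]E set22.
rewrite !inE (ne x y') // orbF [y == x']eq_sym ne //=.
by move=> /eqP -> /eqP ->.
Qed.

(** Union bound for a uniformly random labelling: a given triple [(X, Y, l)] fails with probability
    [(1 - 1/M)^(s^2) <= 2^-k], and there are fewer than [2^k] triples. *)
Lemma pseudorandom_labelling (T : finType) (M s k : nat) :
  0 < M -> M * k <= s * s -> #|T| ^ (2 * s) * M < 2 ^ k ->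
  exists lam : {set T} -> 'I_M, forall (X Y : {set T}) (l : 'I_M),
    [disjoint X & Y] -> #|X| = s -> #|Y| = s ->
    exists x y, [/\ x \in X, y \in Y & lam [set x; y] = l].
Proof.
move=> M_gt0 leMk lt2k; pose tot := #|{set T}|.
pose P (p : {set T} * {set T} * 'I_M) :=
  [&& [disjoint p.1.1 & p.1.2], #|p.1.1| == s & #|p.1.2| == s].
pose E (p : {set T} * {set T} * 'I_M) :=
  [set [set x; y] | x in p.1.1, y in p.1.2].
pose bad p := [set lam : {ffun {set T} -> 'I_M} |
  [forall e in E p, lam e != p.2]].
have card_bad p : P p -> #|bad p| * 2 ^ k <= M ^ tot.
  case/and3P => dXY /eqP cX /eqP cY.
  (* Badness restricts each value separately, so the bad labellings form a product. *)
  pose F (e : {set T}) : pred 'I_M :=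
    if e \in E p then [pred i | i != p.2] else predT.
  have -> : #|bad p| = #|(family F : simpl_pred {ffun {set T} -> 'I_M})|.
    rewrite /bad cardsE; apply: eq_card => lam; rewrite !inE.
    apply/forall_inP/forallP => [lamP e|lamP e eE].
      rewrite -[_ (mem (F e))]/(F e (lam e)) /F.
      by case eE: (e \in E p) => //=; exact: lamP.
    by have : F e (lam e) := lamP e; rewrite /F eE.
  rewrite (@card_family _ (fun=> 'I_M) F) foldrE big_map big_enum /=.
  rewrite (bigID [in E p]) /=.
  rewrite (eq_bigr (fun=> M.-1)); last first.
    move=> e eE; rewrite /F eE; have := cardC1 p.2; rewrite card_ord => <-.
    by apply: eq_card => i; rewrite !inE.
  rewrite [X in _ * X * _](eq_bigr (fun=> M)); last first.
    by move=> e /negPf eE; rewrite /F eE -[RHS]card_ord; apply: eq_card.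
  rewrite !prod_nat_const.
  have -> : tot = s * s + #|[predC E p]|.
    by rewrite -{1}cX -cY -card_pairs // -[RHS]/(_ + #|[predC E p]|) cardC.
  rewrite expnD mulnAC leq_mul //.
  by rewrite card_pairs // cX cY mulnC double_expn_pred_exp.
have card_P : #|[set p | P p]| <= #|T| ^ (2 * s) * M.
  pose D := [set X : {set T} | #|X| == s].
  have leD : #|D| <= #|T| ^ s by rewrite card_draws leq_bin_exp.
  apply: (@leq_trans #|setX (setX D D) [set: 'I_M]|).
    apply: subset_leq_card; apply/subsetP => -[[X Y] l].
    by rewrite !inE /P /= andbT => /andP [_].
  rewrite !cardsX cardsT card_ord leq_mul2r; apply/orP; right.
  by rewrite mul2n -addnn expnD leq_mul.
have [lam lamP] : exists lam, lam \notin \bigcup_(p in [set p | P p]) bad p.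
  apply/existsP; rewrite -negb_forall; apply/negP => /forallP all_bad.
  have : M ^ tot * 2 ^ k <= #|[set p | P p]| * M ^ tot.
    have -> : M ^ tot = #|{ffun {set T} -> 'I_M}| by rewrite card_ffun card_ord.
    apply: (@leq_trans (#|\bigcup_(p in [set p | P p]) bad p| * 2 ^ k)).
      rewrite leq_mul2r; apply/orP; right; apply: subset_leq_card.
      by apply/subsetP => lam _; apply: all_bad.
    apply: (@leq_trans ((\sum_(p in [set p | P p]) #|bad p|) * 2 ^ k)).
      by rewrite leq_mul2r card_big_setU orbT.
    rewrite big_distrl /= card_ffun card_ord -sum_nat_const.
    by apply: leq_sum => p; rewrite inE => /card_bad.
  rewrite mulnC leq_pmul2r ?expn_gt0 ?M_gt0 // leqNgt => /negP; apply.
  exact: leq_ltn_trans lt2k.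
exists lam => X Y l dXY cX cY.
have : lam \notin bad (X, Y, l).
  apply/negP => b; case/negP: lamP; apply/bigcupP; exists (X, Y, l) => //.
  by rewrite inE /P /= dXY cX cY !eqxx.
rewrite inE negb_forall => /existsP [e]; rewrite negb_imply negbK.
by case/andP => /imset2P [x y xX yY ->] /eqP lamE; exists x, y.
Qed.

(** * Copies in labelled complete graphs *)

Section EdgeOrder.
Variables (V : finType) (H : eograph V).

Definition edge_adj : rel V := fun u v => [set u; v] \in edges H.

(** The position of [e] in the order, counted from zero, used as a letter of the alphabet. *)
Definition edge_rank (e : {set V}) :=
  #|[set e' in edges H | ~~ edge_le H e e']|.

Lemma edge_adj_sym : symmetric edge_adj.
Proof. by move=> u v; rewrite /edge_adj setUC. Qed.

Lemma edge_adj_irr : irreflexive edge_adj.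
Proof.
move=> u; apply/negP => /(@edges_card2 _ H).
by rewrite setUid cards1.
Qed.

Lemma edge_adj_vertices u v :
  edge_adj u v -> u \in vertices H /\ v \in vertices H.
Proof.
by move=> /(@edges_sub _ H) /subsetP sub; split; apply: sub; rewrite !inE eqxx ?orbT.
Qed.

Lemma edgeP e : e \in edges H -> exists u v, e = [set u; v] /\ edge_adj u v.
Proof.
move=> eH; have /eqP/cards2P [u [v [_ def_e]]] := edges_card2 eH.
by exists u, v; rewrite /edge_adj -def_e.
Qed.

Lemma edge_le_refl e : e \in edges H -> edge_le H e e.
Proof. by move=> eH; have := edge_le_total eH eH; rewrite orbb. Qed.

Lemma ltn_edge_rank e : e \in edges H -> edge_rank e < #|edges H|.
Proof.
move=> eH; apply: proper_card; apply/properP; split.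
  by apply/subsetP => e'; rewrite inE => /andP [].
by exists e => //; rewrite inE eH edge_le_refl.
Qed.

(** The sets of strictly smaller edges are nested along the order; if [e2] lies strictly below [e1],
    it witnesses strict inclusion. *)
Lemma edge_le_rank :
  {in edges H &, forall e1 e2,
    edge_le H e1 e2 = (edge_rank e1 <= edge_rank e2)}.
Proof.
move=> e1 e2 H1 H2.
have sub e e' : e \in edges H -> e' \in edges H -> edge_le H e e' ->
    [set x in edges H | ~~ edge_le H e x] \subset
    [set x in edges H | ~~ edge_le H e' x].
  move=> eH eH' le; apply/subsetP => x; rewrite !inE => /andP [xH] nle.
  rewrite xH; apply/negP => le'; case/negP: nle.
  exact: (@edge_le_trans _ H _ _ _ eH' eH xH).
case: (boolP (edge_le H e1 e2)) => le12.
  by apply/esym; apply: subset_leq_card; apply: sub.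
have le21 : edge_le H e2 e1.
  by have := edge_le_total H1 H2; rewrite (negPf le12).
apply/esym/negbTE; rewrite -ltnNge; apply: proper_card; apply/properP.
by split; [exact: sub | exists e2; rewrite !inE H2 ?edge_le_refl].
Qed.

Lemma edge_rank_inj : {in edges H &, injective edge_rank}.
Proof.
move=> e1 e2 H1 H2 E; apply: (edge_le_anti H1 H2).
by rewrite !edge_le_rank // E leqnn.
Qed.

(** Neighbours [u] of [v] inject into the edges [[set v; u]]. *)
Lemma edge_adj_degenerate d :
  degenerate d H -> hereditarily_degenerate edge_adj d (vertices H).
Proof.
move=> degH S SH S0; have [v vS dv] := degH S SH S0; exists v => //.
apply: leq_trans dv; rewrite -(@card_in_imset _ _ (fun u => [set v; u])).
  apply: subset_leq_card; apply/subsetP => e /imsetP [u]; rewrite inE.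
  case/andP => uS a ->; rewrite !inE eqxx [_ \in edges H]a !andbT /=.
  by apply/subsetP => w; rewrite !inE => /orP [] /eqP ->.
move=> u w; rewrite !inE => /andP [_ au] /andP [_ aw] E.
have : u \in [set v; w] by rewrite -E set22.
rewrite !inE => /orP [/eqP uv|/eqP //].
by rewrite uv edge_adj_irr in au.
Qed.

Lemma card_edges : #|edges H| <= #|vertices H| ^ 2.
Proof.
apply: leq_trans (leq_bin_exp _ _); rewrite -cards_draws.
apply: subset_leq_card; apply/subsetP => e eH; rewrite inE.
by rewrite (edges_sub eH) (edges_card2 eH).
Qed.
End EdgeOrder.

Section LabelledGraph.
Variables (W : finType) (M : nat) (lam : {set W} -> 'I_M).

(* Orders the edges by label, breaking ties arbitrarily. *)
Definition label_key (e : {set W}) : nat := lam e * #|{set W}| + enum_rank e.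

Lemma label_key_inj : injective label_key.
Proof.
move=> e1 e2 E; apply: enum_rank_inj; apply: val_inj => /=.
have := congr1 (modn^~ #|{set W}|) E.
by rewrite /label_key !modnMDl !modn_small.
Qed.

Lemma ltn_label_key e1 e2 : lam e1 < lam e2 -> label_key e1 < label_key e2.
Proof.
move=> lt; rewrite /label_key; apply: (@leq_trans ((lam e1).+1 * #|{set W}|)).
  by rewrite mulSnr ltn_add2l.
by apply: leq_trans (leq_addr _ _); rewrite leq_mul2r lt orbT.
Qed.

Lemma labelled_card2 :
  {in [set e : {set W} | #|e| == 2], forall e : {set W}, #|e| = 2}.
Proof. by move=> e; rewrite inE => /eqP. Qed.

Lemma labelled_sub :
  {in [set e : {set W} | #|e| == 2], forall e : {set W}, e \subset [set: W]}.
Proof. by move=> e _; apply: subsetT. Qed.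

Lemma labelled_anti (E : {set {set W}}) :
  {in E &, antisymmetric (fun e1 e2 => label_key e1 <= label_key e2)}.
Proof. by move=> e1 e2 _ _ /anti_leq /label_key_inj. Qed.

Lemma labelled_trans (E : {set {set W}}) :
  {in E & &, transitive (fun e1 e2 => label_key e1 <= label_key e2)}.
Proof. by move=> e1 e2 e3 _ _ _; apply: leq_trans. Qed.

Lemma labelled_total (E : {set {set W}}) :
  {in E &, total (fun e1 e2 => label_key e1 <= label_key e2)}.
Proof. by move=> e1 e2 _ _; apply: leq_total. Qed.

Definition labelled_complete : eograph W :=
  EOGraph labelled_card2 labelled_sub (labelled_anti (E := _))
    (labelled_trans (E := _)) (labelled_total (E := _)).

(** Division by [q] drops the last digits of a label and is monotone, so a larger rank forces a
    larger label; ties in [label_key] never decide. *)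
Lemma labelled_copy (V : finType) (H : eograph V) (f : V -> W)
    (chi : {set W} -> bool) (c : bool) (q a : nat) :
  {in vertices H &, injective f} ->
  (forall u v, edge_adj H u v -> chi [set f u; f v] = c /\
     lam [set f u; f v] %/ q = a + edge_rank H [set u; v]) ->
  exists K, is_copy H labelled_complete K /\ monochromatic chi K.
Proof.
move=> f_inj f_edge.
have f2 u v : f @: [set u; v] = [set f u; f v] by rewrite imsetU1 imset_set1.
have fE e : e \in edges H -> chi (f @: e) = c /\
    lam (f @: e) %/ q = a + edge_rank H e.
  by case/edgeP => u [v [-> adj]]; rewrite f2; exact: f_edge.
pose F := [set f @: (e : {set V}) | e in edges H].
have F2 : {in F, forall e : {set W}, #|e| = 2}.
  move=> _ /imsetP [e eH ->]; rewrite card_in_imset; first exact: (@edges_card2 _ H).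
  move/subsetP: (edges_sub eH) => sub x y xe ye.
  by apply: f_inj; apply: sub.
have Fsub : {in F, forall e : {set W}, e \subset f @: vertices H}.
  by move=> _ /imsetP [e eH ->]; rewrite imsetS ?edges_sub.
pose K := EOGraph F2 Fsub (labelled_anti (E := _))
  (labelled_trans (E := _)) (labelled_total (E := _)).
exists K; split; last by exists c => _ /imsetP [e eH ->]; case: (fE e eH).
split; first split=> //.
- exact: subsetT.
- by apply/subsetP => e eF; rewrite inE F2.
exists f; split=> // [u v uH vH | e1 e2 H1 H2] /=.
- apply/idP/idP => [/imsetP [e eH def_e]|adj]; last by rewrite -f2 imset_f.
  (* Injectivity on the vertices recovers an edge from its image. *)
  suff -> : [set u; v] = e by [].
  have sub : forall x, x \in e -> x \in vertices H.
    by apply/subsetP; exact: edges_sub.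
  apply/setP => x; apply/idP/idP => [|xe].
    have fin y : y \in vertices H -> f y \in [set f u; f v] -> y \in e.
      move=> yH; rewrite def_e => /imsetP [z ze /f_inj -> //].
      exact: sub.
    by rewrite !inE => /orP [] /eqP ->; apply: fin; rewrite // !inE eqxx ?orbT.
  have : f x \in [set f u; f v] by rewrite def_e imset_f.
  have xH := sub _ xe.
  by rewrite !inE => /orP [] /eqP /f_inj -> //; rewrite eqxx ?orbT.
- have [_ l1] := fE _ H1; have [_ l2] := fE _ H2.
  have lt e e' : e \in edges H -> e' \in edges H ->
      edge_rank H e < edge_rank H e' -> label_key (f @: e) < label_key (f @: e').
    move=> eH eH' lt; apply: ltn_label_key; rewrite ltnNge.
    apply/negP => /(leq_div2r q); case: (fE _ eH) => _ ->.
    by case: (fE _ eH') => _ ->; rewrite leq_add2l leqNgt lt.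
  rewrite edge_le_rank //; case: (ltngtP (edge_rank H e1) (edge_rank H e2)).
  + by move=> /(lt _ _ H1 H2) /ltnW.
  + by move=> /(lt _ _ H2 H1) lt'; rewrite leqNgt lt'.
  + by move=> /edge_rank_inj -> //; rewrite leqnn.
Qed.
End LabelledGraph.

(** * Sparse parts and the blue embedding *)

Lemma sum_nat_bool (T : finType) (Y : {set T}) (p : pred T) :
  \sum_(y in Y) (p y : nat) = #|[set y in Y | p y]|.
Proof.
rewrite -sum1dep_card big_mkcondr /=.
by apply: eq_bigr => y _; case: (p y).
Qed.

(** Markov's inequality, free of division. *)
Lemma markov_card (T : finType) (X : {set T}) (h : T -> nat) (g m : nat) :
  #|[set x in X | m < g * h x]| * m <= g * \sum_(x in X) h x.
Proof.
rewrite -sum_nat_const big_distrr /=.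
rewrite [X in _ <= X](bigID (fun x => m < g * h x)) /=.
apply: leq_trans (leq_addr _ _); rewrite big_mkcond [X in _ <= X]big_mkcond /=.
apply: leq_sum => x _; rewrite inE.
by case: ifP => // /andP [_ /ltnW].
Qed.

Lemma leq_sub_half a b c : 2 * a <= c -> 2 * b <= c -> a <= c - b.
Proof. lia. Qed.

(** Multiply by [g * G * y] and chain the hypotheses. In the application [w] counts the exceptional
    elements among [x]. *)
Lemma cancel_scaled_bound (g G x y w z m : nat) :
  0 < g -> 0 < G -> 0 < y -> g * (w * y) <= m -> 2 * m * G <= g * z ->
  z <= G * (x * y) -> 2 * w <= x.
Proof.
move=> g_gt0 G_gt0 y_gt0 le_m le_g le_z.
have : g * G * y * (2 * w) <= g * G * y * x.
  apply: (@leq_trans (g * (G * (x * y)))); last by rewrite eq_leq //; lia.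
  apply: (@leq_trans (g * z)); last by rewrite leq_mul2l le_z orbT.
  apply: leq_trans le_g; apply: (@leq_trans (2 * (g * (w * y)) * G)).
    by rewrite eq_leq //; lia.
  by rewrite leq_mul2r leq_mul2l le_m !orbT.
by rewrite leq_pmul2l // !muln_gt0 g_gt0 G_gt0.
Qed.

Section MonochromaticCopy.
Variables (V W : finType) (H : eograph V) (M : nat) (lam : {set W} -> 'I_M).
Variables (chi : {set W} -> bool) (d n b : nat) (s : seq V).
Hypothesis no_copy :
  ~ exists K, is_copy H (labelled_complete lam) K /\ monochromatic chi K.
Hypotheses (uniq_s : uniq s) (s_vertices : s =i vertices H).
Hypothesis deg_s : back_degenerate (edge_adj H) d s.
Hypotheses (card_vertices : #|vertices H| = n) (n_gt0 : 0 < n).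
Hypothesis card_edges_b : #|edges H| <= b.
Hypothesis b_gt0 : 0 < b.
Variable w0 : W.

Let size_s : size s <= n.
Proof.
rewrite -card_vertices -(card_uniqP uniq_s).
by rewrite (eq_card s_vertices).
Qed.

(** If all image pairs had colour [c] and a label extending [a] followed by the edge rank,
    [labelled_copy] would give a copy. So [R_rich] must fail for some edge. *)
Lemma greedy_copy_failure (c : bool) (a j g : nat) (C : V -> {set W}) :
  0 < g ->
  {in vertices H, forall v, 0 < #|C v|} ->
  {in vertices H &, forall u v, u != v -> [disjoint C u & C v]} ->
  exists u v (X Y : {set W}), [/\ edge_adj H u v,
    (X \subset C u) && (Y \subset C v),
    #|C u| <= n * g ^ d * #|X|, #|C v| <= g ^ d * #|Y|
    & {in X, forall w, g * #|[set y in Y | (chi [set w; y] == c) &&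
        (lam [set w; y] %/ b ^ j == a * b + edge_rank H [set u; v])]| < #|Y|}].
Proof.
move=> g_gt0 C_gt0 C_disj; apply: contrapT => no_failure; apply: no_copy.
pose R u v x y := (chi [set x; y] == c) &&
  (lam [set x; y] %/ b ^ j == a * b + edge_rank H [set u; v]).
have [|||f [fC fR]] := @greedy_embedding V W (edge_adj H) R d g n s C uniq_s
    size_s (edge_adj_sym H) (edge_adj_irr H) _ deg_s _ g_gt0 _ w0.
- by move=> u v x y; rewrite /R [[set x; y]]setUC [[set u; v]]setUC.
- by move=> v; rewrite s_vertices; exact: C_gt0.
- move=> u v X Y us vs adj XC YC leX leY; apply: contrapT => poor.
  apply: no_failure; exists u, v, X, Y; split; rewrite ?XC ?YC //.
  by move=> w wX; rewrite ltnNge; apply/negP => rich; apply: poor; exists w.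
apply: (@labelled_copy W M lam V H f chi c (b ^ j) (a * b)).
  move=> u v uH vH E; apply/eqP/negPn/negP => uv.
  have fu := fC u; have fv := fC v; rewrite !s_vertices in fu fv.
  have := disjointFr (C_disj u v uH vH uv) (fu uH).
  by rewrite E fv.
move=> u v adj; have [uH vH] := edge_adj_vertices adj.
have := fR u v; rewrite !s_vertices => /(_ uH vH adj).
by rewrite /R => /andP [/eqP -> /eqP ->].
Qed.

(* Words are numbers written in base [b]: [a] is the prefix obtained by
   dropping the last [j] digits, and red is the colour [true]. *)
Let cls (a j : nat) x y : bool :=
  chi [set x; y] && (lam [set x; y] %/ b ^ j == a).
Let deg (a j : nat) x (Y : {set W}) := \sum_(y in Y) cls a j x y.
Let cnt (a j : nat) (X Y : {set W}) := \sum_(x in X) deg a j x Y.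

Let clsC a j x y : cls a j x y = cls a j y x.
Proof. by rewrite /cls [[set x; y]]setUC. Qed.

Let cntC a j X Y : cnt a j X Y = cnt a j Y X.
Proof.
rewrite /cnt /deg exchange_big; apply: eq_bigr => x _ /=.
by apply: eq_bigr => y _; rewrite clsC.
Qed.

(** Shortening a prefix enlarges the class, so sparsity passes to all extensions of a prefix. *)
Let cls_refine i a j x y : cls a j x y -> cls (a %/ b ^ i) (j + i) x y.
Proof.
case/andP => cxy /eqP <-; rewrite /cls cxy /=.
by rewrite expnD divnMA.
Qed.

Let degS a j x (X Y : {set W}) : X \subset Y -> deg a j x X <= deg a j x Y.
Proof.
move=> /subsetP XY; rewrite /deg [X in X <= _]big_mkcond [X in _ <= X]big_mkcond.
by apply: leq_sum => y _; case: ifP => // /XY ->.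
Qed.

Let cntS a j (X X' Y Y' : {set W}) :
  X \subset X' -> Y \subset Y' -> cnt a j X Y <= cnt a j X' Y'.
Proof.
move=> /subsetP XX YY.
apply: (@leq_trans (cnt a j X Y')); first by apply: leq_sum => x _; apply: degS.
rewrite /cnt [X in X <= _]big_mkcond [X in _ <= X]big_mkcond.
by apply: leq_sum => x _; case: ifP => // /XX ->.
Qed.

Section Sparse.
Variables (g t : nat).
Hypotheses (g_gt0 : 0 < g) (t_gt0 : 0 < t).

(** The red embedding is tried in disjoint parts of size [2 * n * g ^ d * m]; its failure keeps a
    share [1 / (n * g ^ d)] of two of them. The rank of the failing edge becomes the next letter.
    The bound by [M] says that all labels extending the prefix exist. *)
Lemma sparse_pair (S : {set W}) (a j m : nat) :
  a.+1 * b ^ j.+1 <= M -> 0 < m -> n * (2 * n * g ^ d * m) <= #|S| ->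
  exists (A B : {set W}) a', [/\ (A \subset S) && (B \subset S), [disjoint A & B],
    (2 * m <= #|A|) && (2 * m <= #|B|),
    {in A, forall x, g * deg a' j x B <= #|B|}
    & (a' %/ b = a) /\ a'.+1 * b ^ j <= M].
Proof.
move=> aM m_gt0 leS.
have gd_gt0 : 0 < g ^ d by rewrite expn_gt0 g_gt0.
have [|C [CS Cq Cd]] := @exists_disjoint_family V W (vertices H) S
    (2 * n * g ^ d * m); first by rewrite card_vertices.
have [|//|u [v [X [Y [adj /andP [XC YC] leX leY poor]]]]] :=
    @greedy_copy_failure true a j g C g_gt0.
  by move=> v vH; rewrite Cq // !muln_gt0 n_gt0 gd_gt0 m_gt0.
have [uH vH] := edge_adj_vertices adj.
have uv : u != v by apply/eqP => uv; rewrite uv edge_adj_irr in adj.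
have r_lt : edge_rank H [set u; v] < b.
  exact: leq_trans (ltn_edge_rank adj) card_edges_b.
exists X, Y, (a * b + edge_rank H [set u; v]); split.
- by rewrite (subset_trans XC (CS u uH)) (subset_trans YC (CS v vH)).
- exact: disjointWl XC (disjointWr YC (Cd u v uH vH uv)).
- rewrite (Cq u uH) in leX; rewrite (Cq v vH) in leY; apply/andP; split.
    move: leX; have -> : 2 * n * g ^ d * m = n * g ^ d * (2 * m) by lia.
    by rewrite leq_pmul2l ?muln_gt0 ?n_gt0.
  move: leY; have -> : 2 * n * g ^ d * m = g ^ d * (n * (2 * m)) by lia.
  by rewrite leq_pmul2l // => /(leq_trans _) -> //; rewrite leq_pmull.
- move=> x xX; rewrite /deg sum_nat_bool.
  apply: leq_trans (ltnW (poor x xX)); rewrite leq_mul2l; apply/orP; right.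
  by apply: subset_leq_card; apply/subsetP => y; rewrite !inE /cls eqb_id.
- rewrite divnMDl // divn_small // addn0; split=> //.
  apply: leq_trans aM; rewrite expnS mulnA leq_mul2r mulSn; apply/orP; right.
  by lia.
Qed.

(** One doubling costs a factor [n] for the disjoint parts and [2 * n * g ^ d] within each. *)
Definition sparse_size k := (2 * n ^ 2 * g ^ d) ^ k * t.

Definition sparse_rel a j bd : rel {set W} := fun P Q =>
  [disjoint P & Q] && (g * cnt a j P Q <= bd).

Lemma sparse_relW i a j bd bd' P Q : bd <= bd' ->
  sparse_rel (a %/ b ^ i) (j + i) bd P Q -> sparse_rel a j bd' P Q.
Proof.
move=> lebd /andP [dPQ le]; rewrite /sparse_rel dPQ /=.
apply: leq_trans (leq_trans le lebd); rewrite leq_mul2l; apply/orP; right.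
apply: leq_sum => x _; apply: leq_sum => y _.
by case h: (cls a j x y) => //; rewrite (cls_refine i h).
Qed.

(** Take a sparse pair [A], [B], recurse in [A], discard the elements of [B] with too many red pairs
    to the parts found, and recurse in the rest. The letters used number
    [1 + 2 * (2 ^ k - 1) = 2 ^ k.+1 - 1]. *)
Lemma sparse_parts k (S : {set W}) (a j : nat) :
  a.+1 * b ^ (j + (2 ^ k).-1) <= M -> sparse_size k <= #|S| ->
  exists (ps : seq {set W}) a', [/\ size ps = 2 ^ k,
    {in ps, forall P : {set W}, P \subset S /\ #|P| = t},
    pairwise (sparse_rel a' j (2 ^ k * (t * t))) ps
    & (a' %/ b ^ (2 ^ k).-1 = a) /\ a'.+1 * b ^ j <= M].
Proof.
elim: k S a j => [|k IH] S a j aM leS.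
  have [|P PS cP] := @exists_subset_card W S t.
    by move: leS; rewrite /sparse_size expn0 mul1n.
  exists [:: P], a; split=> //; first by move=> Q; rewrite inE => /eqP ->.
  by rewrite expn0 divn1; split=> //; move: aM; rewrite expn0 addn0.
set e := (2 ^ k).-1.
have pow_gt0 : 0 < 2 ^ k by rewrite expn_gt0.
have def_e : (2 ^ k.+1).-1 = (e + e).+1 by rewrite /e expnS; lia.
have ss_gt0 : 0 < sparse_size k.
  by rewrite muln_gt0 t_gt0 expn_gt0 !muln_gt0 !expn_gt0 n_gt0 g_gt0.
(* Of the remaining digits, [e] are reserved for each of the two recursions and [j] stay free. *)
have [|||A [B [a1 [/andP [AS BS] dAB /andP [leA leB] sparse [a1a a1M]]]]] :=
    @sparse_pair S a (j + e + e) (sparse_size k); rewrite ?ss_gt0 //.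
- by move: aM; rewrite def_e addnS addnA.
- move: leS; rewrite /sparse_size expnS.
  by apply: leq_trans; rewrite eq_leq //; lia.
have [|ps [a2 [sz_ps psA pw_ps [a2a1 a2M]]]] := IH A a1 (j + e) a1M.
  by apply: leq_trans leA; lia.
pose U := \bigcup_(P in ps) P.
pose u := 2 ^ k * t.
have u_gt0 : 0 < u by rewrite muln_gt0 pow_gt0.
have UA : U \subset A.
  by apply/bigcupsP => P Pps; case: (psA P Pps).
have cU : #|U| <= u.
  rewrite /U; apply: leq_trans (card_big_setU _ _ _) _.
  rewrite (eq_bigr (fun=> t)) => [|P /psA []//].
  by rewrite sum_nat_const leq_mul2r -sz_ps card_size orbT.
(* The average red degree into [U] is at most [u / g], so by Markov [B'] is at least half of [B];
   the factor 2 in the size of [B] pays for this. *)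
pose B' := [set y in B | g * deg a1 (j + e + e) y U <= 2 * u].
have leB' : #|B| <= 2 * #|B'|.
  pose Bbad := [set y in B | 2 * u < g * deg a1 (j + e + e) y U].
  have cB : #|B| = #|B'| + #|Bbad|.
    rewrite -(cardsID B' B); congr (_ + _).
      by congr #|pred_of_set _|; apply/setP => y; rewrite !inE; case: (y \in B).
    congr #|pred_of_set _|; apply/setP => y; rewrite !inE ltnNge.
    by case: (y \in B); rewrite ?andbF ?andbT.
  have := markov_card B (fun y => deg a1 (j + e + e) y U) g (2 * u).
  rewrite -/Bbad -/(cnt _ _ B U) cntC => leBbad.
  have leU : g * cnt a1 (j + e + e) U B <= u * #|B|.
    apply: leq_trans (_ : #|U| * #|B| <= _); last by rewrite leq_mul2r cU orbT.
    rewrite /cnt big_distrr -sum_nat_const; apply: leq_sum => x xU.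
    by apply: sparse; apply: (subsetP UA).
  have : u * (2 * #|Bbad|) <= u * #|B|.
    by apply: leq_trans leU; apply: leq_trans leBbad; rewrite eq_leq //; lia.
  by rewrite leq_pmul2l //; lia.
have [|qs [a3 [sz_qs qsB pw_qs [a3a2 a3M]]]] := IH B' a2 j a2M.
  by lia.
have B'B : B' \subset B by apply/subsetP => y; rewrite inE => /andP [].
have lebd : 2 ^ k * (t * t) <= 2 ^ k.+1 * (t * t).
  by rewrite leq_mul2r leq_exp2l // leqnSn orbT.
exists (ps ++ qs), a3; split.
- by rewrite size_cat sz_ps sz_qs expnS mul2n addnn.
- move=> P; rewrite mem_cat => /orP [/psA|/qsB] [Psub cP]; split=> //.
    exact: subset_trans Psub AS.
  exact: subset_trans Psub (subset_trans B'B BS).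
- rewrite pairwise_cat; apply/and3P; split.
  + apply/allrelP => P Q /[dup] Pps /psA [PA cP] /qsB [QB cQ].
    (* As [a3] extends [a1], it suffices to count for [a1]: each of the [t] elements of [Q] has at
       most [2 * u / g] red pairs into [U]. *)
    apply: (@sparse_relW (e + e) a3 j (2 ^ k.+1 * (t * t))) => //.
    have -> : a3 %/ b ^ (e + e) = a1 by rewrite expnD divnMA a3a2 a2a1.
    rewrite /sparse_rel addnA; apply/andP; split.
      exact: disjointWl PA (disjointWr (subset_trans QB B'B) dAB).
    have PU : P \subset U by apply/subsetP => x xP; apply/bigcupP; exists P.
    apply: (@leq_trans (g * cnt a1 (j + e + e) Q U)).
      by rewrite leq_mul2l cntC cntS ?orbT.
    have -> : 2 ^ k.+1 * (t * t) = \sum_(y in Q) 2 * u.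
      by rewrite sum_nat_const cQ /u expnS -!mulnA [RHS]mulnCA [t * (2 ^ k * _)]mulnCA.
    rewrite /cnt big_distrr; apply: leq_sum => y yQ /=.
    by have := subsetP QB y yQ; rewrite inE => /andP [].
  + apply: sub_pairwise pw_ps => P Q; rewrite -a3a2.
    exact: sparse_relW.
  + apply: sub_pairwise pw_qs => P Q h.
    by apply: (@sparse_relW 0 a3 j _ _ _ _ lebd); rewrite divn1 addn0.
- split=> //; rewrite def_e -addn1 !expnD expn1 !divnMA a3a2 a2a1.
  exact: a1a.
Qed.
End Sparse.

(** The colour class of [v] selects its part. Failure of the blue embedding gives large [X], [Y]
    with few blue pairs labelled [l]; few red ones exist by sparsity, so subsets of size [s0] avoid
    [l] altogether, against pseudorandomness. *)
Lemma sparse_parts_copy (k g gb t q s0 a bd : nat) (c : V -> 'I_k)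
    (ps : seq {set W}) :
  {in vertices H &, forall u v, edge_adj H u v -> c u != c v} ->
  size ps = k -> {in ps, forall P : {set W}, #|P| = t} ->
  pairwise (sparse_rel g a 1 bd) ps -> a.+1 * b <= M ->
  (forall (X Y : {set W}) (l : 'I_M),
    [disjoint X & Y] -> #|X| = s0 -> #|Y| = s0 ->
    exists x y, [/\ x \in X, y \in Y & lam [set x; y] = l]) ->
  0 < s0 -> 0 < g -> 4 * s0 <= gb -> n * q <= t ->
  2 * s0 * (n * gb ^ d) <= q ->
  2 * gb * bd * (n * gb ^ d * gb ^ d) <= g * (q * q) -> False.
Proof.
move=> c_proper sz_ps ps_card pw aM pseudo s0_gt0 g_gt0 le_gb le_t le_q le_g.
have gb_gt0 : 0 < gb by apply: leq_trans le_gb; rewrite muln_gt0.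
have gbd_gt0 : 0 < gb ^ d by rewrite expn_gt0 gb_gt0.
have q_gt0 : 0 < q by apply: leq_trans le_q; rewrite !muln_gt0 s0_gt0 n_gt0.
pose P v := nth set0 ps (c v).
have Pps v : P v \in ps by rewrite mem_nth // sz_ps.
have Prel u v : c u != c v -> sparse_rel g a 1 bd (P u) (P v).
  have lt u' v' : c u' < c v' -> sparse_rel g a 1 bd (P u') (P v').
    by move=> ltc; apply: (pairwiseP set0 pw); rewrite // inE sz_ps.
  rewrite neq_ltn => /orP [/lt //|/lt].
  by rewrite /sparse_rel disjoint_sym cntC.
have /boolp.choice [F FP] : forall Q, exists C : V -> {set W}, Q \in ps ->
    [/\ {in vertices H, forall v, C v \subset Q},
    {in vertices H, forall v, #|C v| = q}
    & {in vertices H &, forall u v, u != v -> [disjoint C u & C v]}].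
  move=> Q; case: (boolP (Q \in ps)) => Qps; last by exists (fun=> set0).
  have [|C CP] := @exists_disjoint_family V W (vertices H) Q q; last by exists C.
  by rewrite card_vertices ps_card.
pose C v := F (P v) v.
have CS : {in vertices H, forall v, C v \subset P v}.
  by move=> v vH; have [FS _ _] := FP _ (Pps v); apply: FS.
have Cq : {in vertices H, forall v, #|C v| = q}.
  by move=> v vH; have [_ Fq _] := FP _ (Pps v); apply: Fq.
have Cd : {in vertices H &, forall u v, u != v -> [disjoint C u & C v]}.
  move=> u v uH vH uv; case: (eqVneq (c u) (c v)) => [cuv|/Prel /andP [dP _]].
    have [_ _ Fd] := FP _ (Pps u); rewrite /C -[P v]/(nth set0 ps (c v)) -cuv.
    exact: Fd.
  exact: disjointWl (CS u uH) (disjointWr (CS v vH) dP).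
(* With [j = 0] the whole label is prescribed: [a], then the rank as last letter. *)
have [|u [v [X [Y [adj /andP [XC YC] leX leY poor]]]]] :=
    @greedy_copy_failure false a 0 gb C gb_gt0 _ Cd.
  by move=> v vH; rewrite Cq.
have [uH vH] := edge_adj_vertices adj.
rewrite (Cq u uH) in leX; rewrite (Cq v vH) in leY.
have r_lt : edge_rank H [set u; v] < b.
  exact: leq_trans (ltn_edge_rank adj) card_edges_b.
have l_lt : a * b + edge_rank H [set u; v] < M.
  by apply: leq_trans aM; rewrite mulSnr ltn_add2l.
pose l := Ordinal l_lt.
have /andP [dP cntP] := Prel u v (c_proper u v uH vH adj).
have XP := subset_trans XC (CS u uH); have YP := subset_trans YC (CS v vH).
have leX2 : 2 * s0 <= #|X|.
  have : n * gb ^ d * (2 * s0) <= n * gb ^ d * #|X|.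
    by rewrite [X in X <= _]mulnC; apply: leq_trans le_q leX.
  by rewrite leq_pmul2l // muln_gt0 n_gt0.
have leY2 : 2 * s0 <= #|Y|.
  have : gb ^ d * (n * (2 * s0)) <= gb ^ d * #|Y|.
    rewrite mulnA [gb ^ d * n]mulnC [X in X <= _]mulnC.
    exact: leq_trans le_q leY.
  by rewrite leq_pmul2l // => /(leq_trans _) -> //; rewrite leq_pmull.
have Y_gt0 : 0 < #|Y| by apply: leq_trans leY2; rewrite muln_gt0.
pose Xbad := [set x in X | #|Y| < gb * deg a 1 x Y].
have leXbad : 2 * #|Xbad| <= #|X|.
  have le1 : g * (#|Xbad| * #|Y|) <= gb * bd.
    apply: (@leq_trans (g * (gb * cnt a 1 (P u) (P v)))).
      rewrite leq_mul2l; apply/orP; right.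
      apply: leq_trans (markov_card X (fun x => deg a 1 x Y) gb #|Y|) _.
      by rewrite leq_mul2l -/(cnt _ _ X Y) cntS ?orbT.
    by rewrite mulnCA leq_mul2l cntP orbT.
  set G := n * gb ^ d * gb ^ d in le_g.
  have G_gt0 : 0 < G by rewrite /G !muln_gt0 n_gt0 gbd_gt0.
  apply: (cancel_scaled_bound g_gt0 G_gt0 Y_gt0 le1 (z := q * q)).
    by rewrite mulnA.
  by rewrite /G -mulnACA leq_mul.
have [|Xs XsX cXs] := @exists_subset_card W (X :\: Xbad) s0.
  rewrite cardsDS; last by apply/subsetP => x; rewrite inE => /andP [].
  exact: leq_sub_half.
pose N w := [set y in Y | lam [set w; y] == l].
(* A pair labelled [l] is either red with prefix [a], rare outside [Xbad], or blue, rare by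
   [poor]. *)
have leN w : w \in Xs -> gb * #|N w| <= 2 * #|Y|.
  move=> wXs; have := subsetP XsX w wXs; rewrite !inE => /andP [+ wX].
  rewrite wX /= -leqNgt => le_red; have := ltnW (poor w wX).
  set blue := [set y in Y | _] => le_blue.
  rewrite mul2n -addnn; apply: leq_trans (leq_add le_red le_blue).
  rewrite -mulnDr leq_mul2l; apply/orP; right.
  rewrite /deg sum_nat_bool; set redN := [set y in Y | _].
  apply: leq_trans (leq_card_setU redN blue); apply: subset_leq_card.
  apply/subsetP => y; rewrite !inE => /andP [yY /eqP lamE].
  rewrite yY /cls lamE /= !expn1 expn0 divn1 eqxx andbT.
  by rewrite divnMDl // (divn_small r_lt) addn0 eqxx andbT; case: (chi _).
(* These [s0] sets cover at most a share [2 * s0 / gb <= 1/2] of [Y]. *)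
pose N_all := \bigcup_(w in Xs) N w.
have leN_all : 2 * #|N_all| <= #|Y|.
  have : gb * #|N_all| <= s0 * (2 * #|Y|).
    apply: (@leq_trans (gb * \sum_(w in Xs) #|N w|)).
      by rewrite leq_mul2l card_big_setU orbT.
    by rewrite big_distrr -cXs -sum_nat_const; apply: leq_sum => w /leN.
  have : 4 * s0 * #|N_all| <= gb * #|N_all| by rewrite leq_mul2r le_gb orbT.
  move=> /leq_trans h /h; have -> : 4 * s0 * #|N_all| = s0 * (2 * (2 * #|N_all|)).
    by rewrite mulnCA [s0 * (2 * _)]mulnCA !mulnA.
  by rewrite !leq_pmul2l.
have [|Ys YsY cYs] := @exists_subset_card W (Y :\: N_all) s0.
  rewrite cardsDS; first exact: leq_sub_half.
  by apply/bigcupsP => w _; apply/subsetP => y; rewrite inE => /andP [].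
have XsP : Xs \subset P u.
  by apply: subset_trans XP; apply: subset_trans XsX _; apply: subsetDl.
have YsP : Ys \subset P v.
  by apply: subset_trans YP; apply: subset_trans YsY _; apply: subsetDl.
have [x [y [xXs yYs lamE]]] := pseudo Xs Ys l
  (disjointWl XsP (disjointWr YsP dP)) cXs cYs.
have := subsetP YsY y yYs; rewrite inE => /andP [/negP yN yY]; apply: yN.
by apply/bigcupP; exists x; rewrite // inE yY lamE eqxx.
Qed.
End MonochromaticCopy.

(** * Numerical bounds *)

(* Exponents of [n] in, respectively, the ratios lost per back-neighbour in the
   blue and in the red greedy embedding, the size of the sets into which the
   blue copy is embedded, and the number of vertices of the Ramsey graph. *)
Definition blue_exp d := 4 * d + 19.
Definition red_exp d := blue_exp d * (2 * d + 1) + 6.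
Definition piece_exp d := blue_exp d * (d + 1).
Definition ramsey_exp d K := (3 + red_exp d * d) * K + (piece_exp d).+1.

(** With all powers of [d] raised to [d ^ 3], the coefficient of [K] sums to 78 and the other term
    to 47. *)
Lemma ramsey_exp_bound d K :
  0 < d -> 0 < K -> ramsey_exp d K <= 125 * d ^ 3 * K.
Proof.
move=> d_gt0 K_gt0; rewrite /ramsey_exp /red_exp /piece_exp /blue_exp.
have d2 : d <= d ^ 2 by rewrite expnS expn1 leq_pmull.
have d3 : d ^ 2 <= d ^ 3 by rewrite [d ^ 3]expnS leq_pmull.
have -> : ((4 * d + 19) * (2 * d + 1) + 6) * d = 8 * d ^ 3 + 42 * d ^ 2 + 25 * d.
  by rewrite [d ^ 3]expnS expnS expn1; lia.
have -> : (4 * d + 19) * (d + 1) = 4 * d ^ 2 + 23 * d + 19.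
  by rewrite expnS expn1; lia.
move: (d ^ 2) (d ^ 3) d2 d3 => x y d2 d3.
have : 3 + (8 * y + 42 * x + 25 * d) <= 78 * y by lia.
have : (4 * x + 23 * d + 19).+1 <= 47 * y by lia.
by nia.
Qed.

Lemma blue_ratio_bound n d :
  1 < n -> 4 * n ^ (4 * d + 17) <= n ^ blue_exp d.
Proof.
move=> n_gt1.
have -> : blue_exp d = 2 + (4 * d + 17) by rewrite /blue_exp; lia.
rewrite [n ^ (2 + _)]expnD leq_mul2r -[4]/(2 ^ 2) leq_exp2r //.
by rewrite n_gt1 orbT.
Qed.

Lemma piece_bound n d :
  1 < n ->
  2 * n ^ (4 * d + 17) * (n * (n ^ blue_exp d) ^ d) <= n ^ piece_exp d.
Proof.
move=> n_gt1.
have -> : piece_exp d = 1 + (4 * d + 17) + (1 + blue_exp d * d).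
  by rewrite /piece_exp /blue_exp mulnDr muln1; lia.
move: (4 * d + 17) (blue_exp d) => s e.
by rewrite !expnD !expn1 expnM !leq_mul.
Qed.

Section Bounds.
Variables (n d K : nat).
Hypotheses (n_gt1 : 1 < n) (d_gt0 : 0 < d) (d_le_n : d <= n).
Hypotheses (d_lt : d < 2 ^ K) (K_le : 2 ^ K <= 2 * d).

Let leX i j : i <= j -> n ^ i <= n ^ j.
Proof. by move=> ij; rewrite leq_pexp2l // ltnW. Qed.

Let n_gt0 : 0 < n. Proof. exact: ltnW. Qed.

Let K_gt0 : 0 < K.
Proof. by move: d_lt; case: K => //; rewrite expn0; lia. Qed.

Let K_le_d : K <= d.
Proof.
move: K_le; rewrite -{1}(prednK K_gt0) expnS leq_pmul2l // => le.
by have := leq_trans (ltn_expl K.-1 (isT : 1 < 2)) le; rewrite prednK.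
Qed.

Let pow_le_sq : 2 ^ K <= n ^ 2.
Proof.
by apply: leq_trans K_le _; rewrite expnS expn1; apply: leq_mul.
Qed.

(** The origin of [4 * d + 17]: the number of labels is at most [n ^ (4 * d)] since
    [2 ^ K <= 2 * d], and the other factor is at most [n ^ 17]. *)
Lemma labels_bound :
  (n ^ 2) ^ (2 ^ K) * (2 * n * ramsey_exp d K + 2 * n * 2 ^ K + 1) <=
  n ^ (4 * d + 17).
Proof.
rewrite expnD; apply: leq_mul.
  by rewrite -expnM leX //; lia.
have n2 : 2 <= n ^ 1 by rewrite expn1.
have c125 : 125 <= n ^ 7 by apply: (@leq_trans (2 ^ 7)); rewrite // leq_exp2r.
have leE : ramsey_exp d K <= n ^ 11.
  apply: leq_trans (ramsey_exp_bound d_gt0 K_gt0) _.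
  have -> : n ^ 11 = n ^ 7 * n ^ 3 * n by rewrite -expnD -expnSr.
  by rewrite !leq_mul ?leq_exp2r // (leq_trans K_le_d).
have l1 : 2 * n * ramsey_exp d K <= n ^ 13.
  have -> : n ^ 13 = n * n * n ^ 11 by rewrite -mulnA -!expnS.
  by rewrite !leq_mul.
have l2 : 2 * n * 2 ^ K <= n ^ 13.
  apply: (@leq_trans (n ^ 4)); last exact: leX.
  have -> : n ^ 4 = n * n * n ^ 2 by rewrite -mulnA -!expnS.
  by rewrite !leq_mul.
have l3 : 1 <= n ^ 13 by rewrite expn_gt0 n_gt0.
have l4 : 16 <= n ^ 4 by apply: (@leq_trans (2 ^ 4)); rewrite // leq_exp2r.
have -> : n ^ 17 = n ^ 4 * n ^ 13 by rewrite -expnD.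
apply: (@leq_trans (3 * n ^ 13)); first by lia.
by rewrite leq_mul2r (leq_trans _ l4) ?orbT.
Qed.

(** By [n <= 2 ^ n] the number of triples is at most a power of 2 whose exponent [k] exceeds; the
    summand 1 in [k] gives strictness. *)
Lemma pseudorandom_bound (s := n ^ (4 * d + 17))
    (k := s * (2 * n * ramsey_exp d K + 2 * n * 2 ^ K + 1))
    (M := (n ^ 2) ^ (2 ^ K)) :
  M * k <= s * s /\ (n ^ ramsey_exp d K) ^ (2 * s) * M < 2 ^ k.
Proof.
have s_gt0 : 0 < s by rewrite expn_gt0 n_gt0.
split; first by rewrite /k mulnCA leq_mul2l labels_bound orbT.
have n2n : n <= 2 ^ n by rewrite ltnW // ltn_expl.
rewrite /M -!expnM -expnD.
apply: (@leq_ltn_trans ((2 ^ n) ^ (ramsey_exp d K * (2 * s) + 2 * 2 ^ K))).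
  case: (_ + _) => [//|e]; by rewrite leq_exp2r.
rewrite -expnM ltn_exp2l // /k.
move: (2 ^ K) (ramsey_exp d K) => x E.
have : 2 * n * x <= s * (2 * n * x) by rewrite leq_pmull.
have -> : n * (E * (2 * s) + 2 * x) = s * (2 * n * E) + 2 * n * x by lia.
by rewrite !mulnDr muln1; lia.
Qed.

(** [2 * n ^ 2 <= n ^ 3] explains the 3 in [ramsey_exp]. *)
Lemma sparse_size_bound :
  sparse_size d n (n ^ red_exp d) (n ^ (piece_exp d).+1) K <= n ^ ramsey_exp d K.
Proof.
rewrite /sparse_size /ramsey_exp expnD [n ^ (_ * K)]expnM leq_mul2r.
rewrite leq_exp2r // expnD -expnM leq_mul2r.
by rewrite [n ^ 3]expnS leq_mul2r n_gt1 !orbT.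
Qed.

(** The 6 in [red_exp] is made of 1 for the factor 2, 2 for [2 ^ K <= n ^ 2], 2 for [t = n * q]
    squared, and 1 for the factor [n]. *)
Lemma red_ratio_bound (t := n ^ (piece_exp d).+1) (q := n ^ piece_exp d) :
  2 * n ^ blue_exp d * (2 ^ K * (t * t)) *
    (n * (n ^ blue_exp d) ^ d * (n ^ blue_exp d) ^ d) <= n ^ red_exp d * (q * q).
Proof.
have -> : n ^ red_exp d =
    n * n ^ blue_exp d * (n ^ 2 * (n * n)) *
    (n * (n ^ blue_exp d) ^ d * (n ^ blue_exp d) ^ d).
  have -> : red_exp d = 1 + blue_exp d + (2 + (1 + 1)) +
      (1 + blue_exp d * d + blue_exp d * d).
    by rewrite /red_exp mulnDr muln1 mulnCA mul2n -addnn; lia.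
  by move: (blue_exp d) => e; rewrite !expnD !expn1 expnM.
set G := _ * (n ^ _) ^ d; set A := n ^ blue_exp d.
have -> : n * A * (n ^ 2 * (n * n)) * G * (q * q) =
    n * A * (n ^ 2 * (n * q * (n * q))) * G.
  by rewrite mulnAC [n * q * _]mulnACA !mulnA.
rewrite leq_mul2r; apply/orP; right.
by rewrite /t expnS !leq_mul.
Qed.
End Bounds.

(** * Assembly and the final estimate *)

Lemma degenerate_has_ramsey_graph (V : finType) (H : eograph V) (n d K : nat) :
  1 < n -> 0 < d -> d <= n -> d < 2 ^ K -> 2 ^ K <= 2 * d ->
  #|vertices H| = n -> hereditarily_degenerate (edge_adj H) d (vertices H) ->
  has_ramsey_graph H (n ^ ramsey_exp d K).
Proof.
move=> n_gt1 d_gt0 d_le_n d_lt K_le cardH degH.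
have n_gt0 : 0 < n by apply: ltnW.
have nX_gt0 i : 0 < n ^ i by rewrite expn_gt0 n_gt0.
have b_gt0 : 0 < n ^ 2 by exact: nX_gt0.
have card_b : #|edges H| <= n ^ 2 by rewrite -cardH card_edges.
have [s [uniq_s s_vertices deg_s]] := degeneracy_order (edge_adj_irr H) degH.
have [c c_proper] := degenerate_coloring (edge_adj_sym H) (edge_adj_irr H) d_lt degH.
have [leMk lt2k] := pseudorandom_bound n_gt1 d_gt0 d_le_n d_lt K_le.
pose M := (n ^ 2) ^ (2 ^ K).
have M_gt0 : 0 < M by rewrite expn_gt0 b_gt0.
set N := n ^ ramsey_exp d K in lt2k *.
have [|lam pseudo] := @pseudorandom_labelling 'I_N M _ _ M_gt0 leMk.
  by rewrite card_ord.
exists 'I_N, (labelled_complete lam); split; first by rewrite cardsT card_ord.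
move=> chi; apply: contrapT => no_copy.
have w0 : 'I_N := Ordinal (nX_gt0 _ : 0 < N).
have pow_gt0 : 0 < 2 ^ K by rewrite expn_gt0.
(* The prefix starts empty, as [a = 0], and [j = 1] leaves the last letter to the blue embedding. *)
have [||ps [a [sz_ps psP pw [_ aM]]]] := @sparse_parts V 'I_N H M lam chi d n
    (n ^ 2) s no_copy uniq_s s_vertices deg_s cardH n_gt0 card_b b_gt0 w0
    (n ^ red_exp d) (n ^ (piece_exp d).+1) (nX_gt0 _) (nX_gt0 _) K [set: 'I_N] 0 1.
- by rewrite mul1n add1n prednK.
- by rewrite cardsT card_ord (sparse_size_bound n_gt1 d_gt0 d_le_n d_lt K_le).
apply: (@sparse_parts_copy V 'I_N H M lam chi d n (n ^ 2) s no_copy uniq_s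
  s_vertices deg_s cardH n_gt0 card_b b_gt0 w0 _ (n ^ red_exp d)
  (n ^ blue_exp d) (n ^ (piece_exp d).+1) (n ^ piece_exp d) _ _ _ c ps
  c_proper sz_ps _ pw aM pseudo (nX_gt0 _) (nX_gt0 _)) => //.
- by move=> P /psP [].
- exact: blue_ratio_bound.
- by rewrite expnS.
- exact: piece_bound.
- exact: (red_ratio_bound n_gt1 d_gt0 d_le_n d_lt K_le).
Qed.

(** With no edges, [H] is its own Ramsey graph. *)
Lemma edgeless_has_ramsey_graph (V : finType) (H : eograph V) :
  #|vertices H| <= 1 -> has_ramsey_graph H #|vertices H|.
Proof.
move=> le1; exists V, H; split=> // chi; exists H; split; last first.
  exists true => e eH; have := subset_leq_card (edges_sub eH).
  by rewrite (edges_card2 eH) => /leq_trans /(_ le1).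
split; first by split.
exists id; split=> //; first by rewrite imset_id.
by move=> e1 e2 _ _; rewrite !imset_id.
Qed.

Lemma is_redge_leq (V : finType) (H : eograph V) (m : nat) :
  has_ramsey_graph H m -> exists2 N, is_redge H N & N <= m.
Proof.
move=> ramm.
have ex : exists N, `[< has_ramsey_graph H N >] by exists m; apply/asboolP.
case: (ex_minnP ex) => N /asboolP ramN minN.
by exists N; [split=> // M ramM|]; apply: minN; apply/asboolP.
Qed.

Import Order.TTheory GRing.Theory Num.Theory.

(** [2 ^ K <= 2 * d <= (e + 1) ^ 2] gives [K <= 2 * log2 (e + 1)]; 125 is relaxed to 300, which
    doubles to 600. Here [e] is the given degeneracy and [d] its truncation. *)
Lemma ramsey_exp_le_log (R : realType) (d e K : nat) :
  0 < d -> d <= e -> 0 < K -> 2 ^ K <= 2 * d ->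
  ((ramsey_exp d K)%:R <= 600 * e%:R ^+ 3 * log2 (e.+1%:R : R))%R.
Proof.
move=> d_gt0 de K_gt0 K_le.
have ln2_gt0 : (0 < ln 2 :> R)%R by rewrite ln_gt0 // ltr1n.
have leK : (K%:R <= 2 * log2 (e.+1%:R : R))%R.
  rewrite /log2 mulrA ler_pdivlMr // !mulr_natl -!lnXn ?ltr0n //.
  rewrite ler_ln ?posrE ?exprn_gt0 ?ltr0n // -!natrX ler_nat.
  by apply: leq_trans K_le _; nia.
apply: (@le_trans _ _ (125 * d ^ 3 * K)%N%:R%R).
  by rewrite ler_nat ramsey_exp_bound.
apply: (@le_trans _ _ (300 * e%:R ^+ 3 * K%:R)%R).
  rewrite -natrX -!natrM ler_nat leq_mul2r; apply/orP; right.
  by rewrite leq_mul // leq_exp2r.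
have -> : (600 * e%:R ^+ 3 * log2 (e.+1%:R : R) =
    300 * e%:R ^+ 3 * (2 * log2 (e.+1%:R : R)))%R.
  by rewrite [RHS]mulrA [(300 * _ * 2)%R]mulrAC -natrM.
by rewrite ler_wpM2l // mulr_ge0 // exprn_ge0.
Qed.

Theorem theorem4 (R : realType) (V : finType) (H : eograph V) (n d : nat)
    (d_gt0 : 0 < d) (cardH : #|vertices H| = n) (degH : degenerate d H) :
  exists N : nat, is_redge H N /\
    (N%:R <= n%:R `^ (600 * d%:R ^+ 3 * log2 (d.+1%:R : R)) :> R)%R.
Proof.
suff [m ramm le_m] : exists2 m, has_ramsey_graph H m &
    (m%:R <= n%:R `^ (600 * d%:R ^+ 3 * log2 (d.+1%:R : R)) :> R)%R.
  have [N redgeN leN] := is_redge_leq ramm; exists N; split=> //.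
  by apply: le_trans le_m; rewrite ler_nat.
have [n_le1|n_gt1] := leqP n 1.
  exists n; first by rewrite -cardH; apply: edgeless_has_ramsey_graph; rewrite cardH.
  by case: n n_le1 {cardH} => [|[|//]] _; rewrite ?powR_ge0 // powR1.
(* Degrees never exceed [n], so degeneracy survives truncation, and the numerical bounds get
   [d' <= n]. *)
pose d' := minn d n.
have d'_gt0 : 0 < d' by rewrite leq_min d_gt0 ltnW.
have degH' : hereditarily_degenerate (edge_adj H) d' (vertices H).
  move=> S SH S0; have [v vS dv] := edge_adj_degenerate degH SH S0.
  exists v => //; rewrite leq_min dv -cardH; apply: subset_leq_card.
  by apply/subsetP => u; rewrite inE => /andP [/(subsetP SH)].
have /andP [log_le log_gt] := trunc_log_bounds (isT : 1 < 2) d'_gt0.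
(* The least [K] with [d' < 2 ^ K], whence [2 ^ K <= 2 * d']. *)
set K := (trunc_log 2 d').+1 in log_gt.
have K_le : 2 ^ K <= 2 * d' by rewrite expnS leq_mul2l.
exists (n ^ ramsey_exp d' K).
  by apply: degenerate_has_ramsey_graph; rewrite ?geq_minr.
rewrite natrX -powR_mulrn // ler_powR ?ler1n ?(ltnW n_gt1) //.
by apply: ramsey_exp_le_log; rewrite ?geq_minl.
Qed.
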